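(* Let $\mathcal{T},\mathcal{W}\in\mathbb{K}^{R\times R\times 2}$. Assume $\mathcal{T}$ has $\mathbb{K}$-rank $R$ with CPD $[\![\mathbf{A},\mathbf{B},\mathbf{C}]\!]$, where the columns of $\mathbf{C}$ have unit Euclidean norm, and let $\{\mathscr{L}_r\}_{r=1}^R$ be the spectrum of $\mathcal{T}$. If $$\|\mathcal{T}-\mathcal{W}\|_{\mathrm{sp}}<\frac{\sigma_{\min}(\mathbf{A})\,\sigma_{\min}(\mathbf{B})\,\min_{i\neq j}\chi(\mathscr{L}_i,\mathscr{L}_j)}{2},$$ then $\mathcal{W}$ is a simple tensor of $\mathbb{K}$-rank $R$, and $$\mathrm{md}[\mathcal{T},\mathcal{W}]\leq\frac{\|\mathcal{T}-\mathcal{W}\|_{\mathrm{sp}}}{\sigma_{\min}(\mathbf{A})\,\sigma_{\min}(\mathbf{B})}.$$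
   Context: $\mathbb{K}$ denotes $\mathbb{R}$ or $\mathbb{C}$; $\sigma_{\min}$ is the smallest (possibly zero) singular value. $\mathbb{K}$-rank and CPD $[\![\mathbf{A},\mathbf{B},\mathbf{C}]\!]=\sum_r\mathbf{a}_r\otimes\mathbf{b}_r\otimes\mathbf{c}_r$ as usual (minimal number of rank one terms with $\mathbb{K}$-factors). For $\mathcal{T}\in\mathbb{K}^{R\times R\times K}$ with slices $\mathbf{T}_k$: a nonzero $\mathbf{x}$ is a JGE vector if $\mathbf{T}_\ell\mathbf{x}=\lambda_\ell\mathbf{y}$ for all $\ell$ for some $\boldsymbol{\lambda}\in\mathbb{K}^K$ and nonzero $\mathbf{y}$; $\mathrm{span}(\boldsymbol{\lambda})$ is then a JGE value. The characteristic polynomial is $p_{\mathcal{T}}(\boldsymbol{\gamma})=\det(\sum_k\gamma_k\mathbf{T}_k)$; the algebraic multiplicity of $\mathrm{span}(\boldsymbol{\lambda})$ is the largest $m$ with $(\sum_k\lambda_k\gamma_k)^m\mid p_{\mathcal{T}}$. If $p_{\mathcal{T}}\not\equiv0$ factors as a product of $R$ linear forms $\prod_r(\sum_k\lambda_{r,k}\gamma_k)$, the spectrum is the list $\mathrm{span}(\boldsymbol{\lambda}_1),\dots,\mathrm{span}(\boldsymbol{\lambda}_R)$ (with multiplicity); for $\mathcal{T}=[\![\mathbf{A},\mathbf{B},\mathbf{C}]\!]$ of rank $R$ with $\mathbf{A},\mathbf{B}$ invertible it consists of the spans of the columns of $\mathbf{C}$. $\mathcal{T}$ is simple if some linear combination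 of its slices is invertible and $p_{\mathcal{T}}$ is a product of $R$ pairwise non-proportional linear forms. Chordal metric: $\chi(\mathscr{L}_1,\mathscr{L}_2)$ is the sine of the angle between one-dimensional subspaces. Matching distance: for spectra $\{\mathscr{L}_{1,r}\}$, $\{\mathscr{L}_{2,r}\}$ of $\mathcal{T}_1,\mathcal{T}_2$, $\mathrm{md}[\mathcal{T}_1,\mathcal{T}_2]=\min_{\pi\in S_R}\max_{r}\chi(\mathscr{L}_{1,r},\mathscr{L}_{2,\pi(r)})$. Spectral norm: $\|\mathcal{M}\|_{\mathrm{sp}}=\max_{\|\mathbf{x}\|=\|\mathbf{y}\|=\|\mathbf{z}\|=1}|\mathcal{M}\cdot_1\mathbf{x}\cdot_2\mathbf{y}\cdot_3\mathbf{z}|$. *)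

(* Defs.v *)
(* K is modelled inside C := R[i] (R : realType) by the
   boolean [realK]: realK = true means K = R (entries with zero imaginary
   part), realK = false means K = C. *)
From HB Require Import structures.
From mathcomp Require Import all_boot all_order all_algebra all_fingroup.
From mathcomp Require Import reals.
From mathcomp.real_closed Require Import complex.
Set Implicit Arguments. Unset Strict Implicit. Unset Printing Implicit Defensive.
Import Order.TTheory GRing.Theory Num.Theory.
Local Open Scope ring_scope.

Section Defs.
Variable C : numClosedFieldType.

Definition inK (realK : bool) (x : C) : bool := if realK then x \is Num.real else true.
Definition mxK realK m n (A : 'M[C]_(m, n)) := forall i j, inK realK (A i j).
Definition vecK realK n (x : 'I_n -> C) := forall i, inK realK (x i).

(* third-order tensors in C^{I x J x K}, stored by frontal slices T_k *)
Definition tensor (I J K : nat) := {ffun 'I_K -> 'M[C]_(I, J)}.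
Definition tensK realK I J K (T : tensor I J K) := forall k, mxK realK (T k).
Definition tsub I J K (T W : tensor I J K) : tensor I J K := [ffun k => T k - W k].

Definition cpd I J K F (A : 'M[C]_(I, F)) (B : 'M[C]_(J, F)) (Cm : 'M[C]_(K, F))
  : tensor I J K :=
  [ffun k => \matrix_(i, j) \sum_(r < F) A i r * B j r * Cm k r].

Definition has_KCPD realK I J K (T : tensor I J K) (F : nat) :=
  exists (A : 'M[C]_(I, F)) (B : 'M[C]_(J, F)) (Cm : 'M[C]_(K, F)),
    [/\ mxK realK A, mxK realK B, mxK realK Cm & T = cpd A B Cm].

Definition has_Krank realK I J K (T : tensor I J K) (r : nat) :=
  has_KCPD realK T r /\ forall F, (F < r)%N -> ~ has_KCPD realK T F.

Definition charp R K (T : tensor R R K) (g : 'I_K -> C) : C :=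
  \det (\sum_(k < K) g k *: T k).

(* lam : R linear forms with coefficients in K whose product is p_T (p_T /= 0).
   The spectrum of T is then the list span(lam 0), ..., span(lam (R-1)). *)
Definition is_spectrum realK R K (T : tensor R R K) (lam : 'I_R -> 'I_K -> C) :=
  [/\ exists g, charp T g != 0,
      forall r, vecK realK (lam r)
    & forall g : 'I_K -> C, charp T g = \prod_(r < R) \sum_(k < K) lam r k * g k].

Definition proportional K (u v : 'I_K -> C) := exists c : C, forall k, u k = c * v k.

Definition simple realK R K (T : tensor R R K) :=
  (exists g : 'I_K -> C, vecK realK g /\ (\sum_(k < K) g k *: T k) \in unitmx) /\
  exists lam, is_spectrum realK T lam /\
    forall i j : 'I_R, i != j -> ~ proportional (lam i) (lam j).

Definition vnorm n (u : 'I_n -> C) : C := sqrtC (\sum_(i < n) `|u i| ^+ 2).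
Definition vdot n (u v : 'I_n -> C) : C := \sum_(i < n) (u i)^* * v i.

(* chordal metric: sine of the angle between span u and span v *)
Definition chi n (u v : 'I_n -> C) : C :=
  sqrtC (1 - (`|vdot u v| / (vnorm u * vnorm v)) ^+ 2).

Definition contract I J K (M : tensor I J K) x y z : C :=
  \sum_(i < I) \sum_(j < J) \sum_(k < K) M k i j * x i * y j * z k.
Definition unitK realK n (x : 'I_n -> C) := vecK realK x /\ vnorm x = 1.
Definition is_spnorm realK I J K (M : tensor I J K) (s : C) :=
  (forall x y z, unitK realK x -> unitK realK y -> unitK realK z ->
     `|contract M x y z| <= s) /\
  exists x y z, [/\ unitK realK x, unitK realK y, unitK realK z &
     `|contract M x y z| = s].

Definition adjmx m n (A : 'M[C]_(m, n)) : 'M[C]_(n, m) := (map_mx Num.conj A)^T.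
Definition is_sigma_min n (A : 'M[C]_n) (s : C) :=
  [/\ 0 <= s, eigenvalue (adjmx A *m A) (s ^+ 2)
    & forall e, eigenvalue (adjmx A *m A) e -> s ^+ 2 <= e].

End Defs.

(* Main.v *)
Require Import Defs.
From HB Require Import structures.
From mathcomp Require Import all_boot all_order all_algebra all_fingroup.
From mathcomp Require Import reals ring spectral.
From mathcomp.real_closed Require Import complex.
Set Implicit Arguments. Unset Strict Implicit. Unset Printing Implicit Defensive.
Import Order.TTheory GRing.Theory Num.Theory.
Local Open Scope ring_scope.

(** For unit vectors of K^2 the chordal distance is [|u0 v1 - u1 v0|], and a
    line v is a root of a tensor when the slice combination along [perp v] is
    singular.  A Bauer-Fike estimate shows that every K-root of
    [T + t (W - T)], [0 <= t <= 1], lies within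
    [eps = s / (sigma_min A * sigma_min B)] of a column of C; by the gap
    hypothesis the n discs of radius eps are disjoint.  We move t from 0 to 1 in
    finitely many steps, with the invariant that every disc contains a K-root.
    Over C, the characteristic form at the next t is a product of n unit linear
    forms with a factor bounded below, and it is small at each old root, so some
    new root is near each old one, and distinct discs get distinct new roots.
    When K = R the coefficients are real, so complex conjugation permutes the new
    roots; as there is exactly one near each real old root, it is real.
    At t = 1 the n pairwise distinct K-roots give the factorization of p_W, the
    CPD of W (kernel vectors are joint generalized eigenvectors), and the
    matching. *)

(** * The projective line with the chordal metric *)

Lemma sum_ord2 (V : nmodType) (F : 'I_2 -> V) : \sum_(k < 2) F k = F 0 + F 1.
Proof.
by rewrite !big_ord_recl big_ord0 addr0; congr (F _ + F _); apply/val_inj.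
Qed.

Lemma ord2P (P : 'I_2 -> Prop) : P 0 -> P 1 -> forall k, P k.
Proof.
move=> P0 P1 [[|[|//]] h].
  by rewrite (_ : Ordinal h = 0) //; apply/val_inj.
by rewrite (_ : Ordinal h = 1) //; apply/val_inj.
Qed.

Section Plane.
Variable C : numClosedFieldType.
Implicit Types (realK : bool) (u v z : 'I_2 -> C).

Definition wedge u v : C := u 0 * v 1 - u 1 * v 0.

(* The linear form with coefficients u vanishes at perp v exactly when
   span u = span v; hence the zeros of p_T are the perp v with v in the spectrum. *)
Definition perp v : 'I_2 -> C := fun k => if k == 0 then v 1 else - v 0.

Lemma form_perp u v : \sum_(k < 2) u k * perp v k = wedge u v.
Proof. by rewrite sum_ord2 /perp /wedge /= mulrN. Qed.

Lemma vnorm_sq n (u : 'I_n -> C) : vnorm u ^+ 2 = \sum_(i < n) `|u i| ^+ 2.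
Proof. by rewrite sqrtCK. Qed.

Lemma vnorm_ge0 n (u : 'I_n -> C) : 0 <= vnorm u.
Proof. by rewrite sqrtC_ge0; apply: sumr_ge0 => i _; rewrite exprn_ge0. Qed.

Lemma vnorm_sq1 n (u : 'I_n -> C) : \sum_(i < n) `|u i| ^+ 2 = 1 -> vnorm u = 1.
Proof. by rewrite /vnorm => ->; rewrite sqrtC1. Qed.

Lemma vnorm_eq0 n (u : 'I_n -> C) : vnorm u = 0 -> forall i, u i = 0.
Proof.
move=> u0 i; have /eqP := vnorm_sq u.
rewrite u0 expr0n /= eq_sym => /eqP /psumr_eq0P => /(_ (fun i _ => exprn_ge0 _ (normr_ge0 _))).
by move=> /(_ i isT) /eqP; rewrite expf_eq0 /= normr_eq0 => /eqP.
Qed.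

Lemma vnormZ n (a : C) (u v : 'I_n -> C) :
  (forall k, v k = a * u k) -> vnorm v = `|a| * vnorm u.
Proof.
move=> e; rewrite -[RHS]sqrCK ?mulr_ge0 ?vnorm_ge0 // exprMn vnorm_sq mulr_sumr.
by congr sqrtC; apply: eq_bigr => k _; rewrite e normrM exprMn.
Qed.

Lemma vnorm_normalize n (u : 'I_n -> C) i : u i != 0 ->
  vnorm u != 0 /\ vnorm (fun k => (vnorm u)^-1 * u k) = 1.
Proof.
move=> ui; have n0 : vnorm u != 0 by apply: contra ui => /eqP /vnorm_eq0 ->.
split=> //; rewrite (vnormZ (a := (vnorm u)^-1) (u := u)) //.
by rewrite normfV ger0_norm ?vnorm_ge0 // mulVf.
Qed.

Lemma vnorm_perp v : vnorm (perp v) = vnorm v.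
Proof. by rewrite /vnorm !sum_ord2 /perp /= normrN addrC. Qed.

(** For unit vectors [|vdot u v|] is the cosine of the angle, so this identity makes [|wedge u v|]
    the sine, that is, the chordal distance. *)
Lemma lagrange u v :
  vnorm u ^+ 2 * vnorm v ^+ 2 = `|vdot u v| ^+ 2 + `|wedge u v| ^+ 2.
Proof.
rewrite !vnorm_sq /vdot /wedge !sum_ord2 !normCK.
rewrite !rmorphD !rmorphN !rmorphM /= !conjCK; ring.
Qed.

Lemma lagrange1 u v : vnorm u = 1 -> vnorm v = 1 ->
  `|vdot u v| ^+ 2 + `|wedge u v| ^+ 2 = 1.
Proof. by move=> u1 v1; rewrite -lagrange u1 v1 !expr1n mulr1. Qed.

Lemma vdot_le1 u v : vnorm u = 1 -> vnorm v = 1 -> `|vdot u v| <= 1.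
Proof.
move=> u1 v1; rewrite -(@ler_pXn2r _ 2) ?nnegrE // expr1n -(lagrange1 u1 v1).
by rewrite lerDl exprn_ge0.
Qed.

Lemma wedge_le1 u v : vnorm u = 1 -> vnorm v = 1 -> `|wedge u v| <= 1.
Proof.
move=> u1 v1; rewrite -(@ler_pXn2r _ 2) ?nnegrE // expr1n -(lagrange1 u1 v1).
by rewrite lerDr exprn_ge0.
Qed.

Lemma wedgeC u v : wedge u v = - wedge v u.
Proof. rewrite /wedge; ring. Qed.

Lemma wedgexx u : wedge u u = 0.
Proof. by rewrite /wedge mulrC subrr. Qed.

Lemma norm_wedgeC u v : `|wedge u v| = `|wedge v u|.
Proof. by rewrite wedgeC normrN. Qed.

Lemma wedgeZ (a : C) u v z : (forall k, u k = a * z k) -> wedge u v = a * wedge z v.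
Proof. by move=> e; rewrite /wedge !e; ring. Qed.

Lemma wedge_triangle z u v : vnorm u = 1 -> vnorm v = 1 -> vnorm z = 1 ->
  `|wedge u v| <= `|wedge u z| + `|wedge z v|.
Proof.
move=> u1 v1 z1.
(* Expand [u] along [z] and the conjugate perpendicular of [z]; the identity carries a factor |z|^2,
   which is 1. *)
have -> : wedge u v = vdot z u * wedge z v - wedge z u * vdot z v.
  rewrite -[LHS]mul1r -[1](expr1n _ 2) -{1}z1 vnorm_sq /vdot /wedge !sum_ord2 !normCK.
  ring.
apply: le_trans (ler_normB _ _) _; rewrite !normrM addrC (norm_wedgeC u z) lerD //.
  by rewrite ler_piMr // vdot_le1.
by rewrite ler_piMl // vdot_le1.
Qed.

Lemma wedge0_scale u v : wedge u v = 0 -> vnorm v = 1 ->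
  forall k, u k = vdot v u * v k.
Proof.
move=> w0 v1; have e : v 0 * (v 0)^* + v 1 * (v 1)^* = 1.
  by rewrite -!normCK -(sum_ord2 (fun k => `|v k| ^+ 2)) -vnorm_sq v1 expr1n.
move: w0; rewrite /wedge => /eqP; rewrite subr_eq0 => /eqP w0.
rewrite /vdot sum_ord2; apply: ord2P.
  rewrite -[LHS]mulr1 -e mulrDr mulrCA mulrA -[_ * (v 0)^*]mulrA.
  transitivity (u 0 * v 0 * (v 0)^* + u 0 * v 1 * (v 1)^*); first by ring.
  by rewrite w0; ring.
transitivity (u 1 * v 0 * (v 0)^* + u 1 * v 1 * (v 1)^*); last by rewrite -w0; ring.
by rewrite -[LHS]mulr1 -e; ring.
Qed.

(** Rescaling moves neither line, so [chi] can be computed on unit representatives, where Lagrange's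
    identity turns 1 - cos^2 into [|wedge c d| ^+ 2]. *)
Lemma chi_scale (a b : C) u v c d :
  (forall k, u k = a * c k) -> (forall k, v k = b * d k) ->
  a != 0 -> b != 0 -> vnorm c = 1 -> vnorm d = 1 -> chi u v = `|wedge c d|.
Proof.
move=> eu ev a0 b0 c1 d1; rewrite /chi (vnormZ eu) (vnormZ ev) c1 d1 !mulr1.
have -> : vdot u v = a^* * b * vdot c d.
  by rewrite /vdot !sum_ord2 !eu !ev !rmorphM /=; ring.
rewrite !normrM norm_conjC mulrAC divff ?mul1r; last by rewrite mulf_neq0 ?normr_eq0.
by rewrite -(lagrange1 c1 d1) [X in X - _]addrC addrK sqrCK.
Qed.

(** * Rationality over K *)

Lemma inKD realK (x y : C) : inK realK x -> inK realK y -> inK realK (x + y).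
Proof. by case: realK => //=; apply: rpredD. Qed.
Lemma inKM realK (x y : C) : inK realK x -> inK realK y -> inK realK (x * y).
Proof. by case: realK => //=; apply: rpredM. Qed.
Lemma inKN realK (x : C) : inK realK x -> inK realK (- x).
Proof. by case: realK => //=; rewrite rpredN. Qed.
Lemma inKV realK (x : C) : inK realK x -> inK realK x^-1.
Proof. by case: realK => //=; rewrite rpredV. Qed.
Lemma inK_conj realK (x : C) : inK realK x -> inK realK x^*.
Proof. by case: realK => //= xR; rewrite conj_Creal. Qed.
Lemma inK_real realK (x : C) : x \is Num.real -> inK realK x.
Proof. by case: realK. Qed.
Lemma inK_sum realK I (r : seq I) (F : I -> C) :
  (forall i, inK realK (F i)) -> inK realK (\sum_(i <- r) F i).
Proof. by case: realK => //= h; apply: rpred_sum. Qed.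
Lemma inK_prod realK I (r : seq I) (F : I -> C) :
  (forall i, inK realK (F i)) -> inK realK (\prod_(i <- r) F i).
Proof. by case: realK => //= h; apply: rpred_prod. Qed.

Lemma mxK_det realK n (M : 'M[C]_n) : mxK realK M -> inK realK (\det M).
Proof.
move=> hM; apply: inK_sum => p; apply: inKM; last exact: inK_prod.
by apply: inK_real; rewrite rpredX // rpredN rpred1.
Qed.

Lemma mxK_mul realK m n p (M : 'M[C]_(m, n)) (N : 'M[C]_(n, p)) :
  mxK realK M -> mxK realK N -> mxK realK (M *m N).
Proof. by move=> hM hN i j; rewrite mxE; apply: inK_sum => k; apply: inKM. Qed.

Lemma mxK_inv realK n (M : 'M[C]_n) : mxK realK M -> mxK realK (invmx M).
Proof.
move=> hM i j; rewrite /invmx; case: ifP => // _; rewrite !mxE.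
apply: inKM; first by apply: inKV; apply: mxK_det.
apply: inKM; first by apply: inK_real; rewrite rpredX // rpredN rpred1.
by apply: mxK_det => a b; rewrite !mxE.
Qed.

Lemma mxK_comb realK R K (T : tensor C R R K) (g : 'I_K -> C) :
  tensK realK T -> vecK realK g -> mxK realK (\sum_(k < K) g k *: T k).
Proof.
move=> hT hg i j; rewrite summxE; apply: inK_sum => k; rewrite mxE.
by apply: inKM => //; apply: hT.
Qed.

Lemma vecK_perp realK v : vecK realK v -> vecK realK (perp v).
Proof. by move=> hv; apply: ord2P; rewrite /perp //=; apply: inKN. Qed.

(** When M is real, the real and imaginary parts of a complex kernel vector lie in the kernel too,
    and one of them is nonzero. *)
Lemma mxK_kernel realK n (M : 'M[C]_n) : mxK realK M -> \det M = 0 ->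
  exists x : 'cV[C]_n, [/\ mxK realK x, x != 0 & M *m x = 0].
Proof.
move=> hM d0; have : ~~ row_free M^T by rewrite row_free_unit unitmxE det_tr d0 unitr0.
rewrite -kermx_eq0 => /rowV0Pn [y /sub_kermxP yM y0].
have Mx : M *m y^T = 0 by rewrite -[M]trmxK -trmx_mul yM trmx0.
have x0 : y^T != 0 by apply: contra y0 => /eqP e; rewrite -[y]trmxK e trmx0.
move: y^T Mx x0 => x Mx x0 {y yM y0}.
case: realK hM => hM; last by exists x; split.
have eRe : M *m map_mx (@Re C) x = 0.
  apply/matrixP => i j; have := congr1 (fun N : 'cV_n => 'Re (N i j)) Mx.
  rewrite !mxE raddf0 raddf_sum /= => e0; rewrite -[RHS]e0.
  by apply: eq_bigr => k _; rewrite mxE ReMl //; apply: hM.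
have eIm : M *m map_mx (@Im C) x = 0.
  apply/matrixP => i j; have := congr1 (fun N : 'cV_n => 'Im (N i j)) Mx.
  rewrite !mxE raddf0 raddf_sum /= => e0; rewrite -[RHS]e0.
  by apply: eq_bigr => k _; rewrite mxE ImMl //; apply: hM.
have [r0|r0] := eqVneq (map_mx (@Re C) x) 0; last first.
  by exists (map_mx (@Re C) x); split=> // i j; rewrite mxE /= Creal_Re.
exists (map_mx (@Im C) x); split=> //; first by move=> i j; rewrite mxE /= Creal_Im.
apply: contra x0 => /eqP i0; apply/eqP/matrixP => i j; rewrite [x i j]Crect mxE.
have /matrixP/(_ i j) := r0; have /matrixP/(_ i j) := i0; rewrite !mxE => -> ->.
by rewrite mulr0 addr0.
Qed.

(** For K = R the condition says that the line of [u] is stable under conjugation; removing the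
    phase of one nonzero coordinate then makes every coordinate real. *)
Lemma unitK_phase realK u : vnorm u = 1 ->
  (realK -> wedge u (fun k => (u k)^*) = 0) ->
  exists v a, [/\ unitK realK v, `|a| = 1 & forall k, v k = a * u k].
Proof.
case: realK => u1; last first.
  by move=> _; exists u, 1; split=> // [|k]; rewrite ?normr1 ?mul1r.
move=> /(_ isT) /eqP; rewrite subr_eq0 => /eqP w0.
have [l ul] : exists l, u l != 0.
  have [e0|] := eqVneq (u 0) 0; last by exists 0.
  have [e1|] := eqVneq (u 1) 0; last by exists 1.
  have := vnorm_sq u; rewrite u1 sum_ord2 e0 e1 normr0 expr0n /= addr0 expr1n.
  by move/eqP; rewrite oner_eq0.
have sym k m : u k * (u m)^* = u m * (u k)^*.
  by move: k m; apply: ord2P; apply: ord2P.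
pose a := (u l)^* / `|u l|.
have a1 : `|a| = 1 by rewrite normf_div norm_conjC normr_id divff // normr_eq0.
exists (fun k => a * u k), a; split=> //; split; last by rewrite (vnormZ (u := u) (a := a)) // a1 u1 mulr1.
move=> k; rewrite /= /a mulrAC rpredM //; last by rewrite rpredV realE normr_ge0.
by apply/CrealP; rewrite rmorphM /= conjCK mulrC [RHS]mulrC -sym mulrC.
Qed.

End Plane.

(** * Characteristic forms and singular values *)

Section Estimates.
Variable C : numClosedFieldType.
Implicit Types (realK : bool).

(** Telescoping: the factors are exchanged one at a time, and [1 <= b] lets every partial product be
    bounded by the full power of [b]. *)
Lemma prod_lipschitz I (r : seq I) (F G : I -> C) (b e : C) : 1 <= b -> 0 <= e ->
  (forall i, `|F i| <= b) -> (forall i, `|G i| <= b) ->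
  (forall i, `|F i - G i| <= e) ->
  `|\prod_(i <- r) F i - \prod_(i <- r) G i| <= (size r)%:R * b ^+ size r * e.
Proof.
move=> b1 e0 hF hG hFG; have b0 : 0 <= b by apply: le_trans b1.
elim: r => [|i r IH]; first by rewrite !big_nil subrr normr0 /= !mul0r.
have hp : `|\prod_(j <- r) G j| <= b ^+ size r.
  elim: r {IH} => [|j r IH]; first by rewrite big_nil normr1 expr0.
  by rewrite big_cons normrM exprS ler_pM.
rewrite !big_cons.
have -> : F i * \prod_(j <- r) F j - G i * \prod_(j <- r) G j
  = F i * (\prod_(j <- r) F j - \prod_(j <- r) G j) + (F i - G i) * \prod_(j <- r) G j.
  ring.
apply: le_trans (ler_normD _ _) _; rewrite !normrM /=.
have -> : (size r).+1%:R * b ^+ (size r).+1 * e =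
  b * ((size r)%:R * b ^+ size r * e) + e * b ^+ (size r).+1.
  by rewrite -addn1 natrD exprD expr1; ring.
apply: lerD; first by apply: ler_pM.
apply: ler_pM => //; apply: le_trans hp _.
by rewrite exprS ler_peMl // exprn_ge0.
Qed.

Lemma det_lipschitz n (b : C) : 1 <= b -> exists2 L : C, 0 <= L &
  forall (X Y : 'M[C]_n) e, 0 <= e -> (forall i j, `|X i j| <= b) ->
    (forall i j, `|Y i j| <= b) -> (forall i j, `|X i j - Y i j| <= e) ->
    `|\det X - \det Y| <= L * e.
Proof.
move=> b1; have b0 : 0 <= b by apply: le_trans b1.
pose N := size (index_enum 'I_n).
exists (\sum_(p : 'S_n) N%:R * b ^+ N).
  by apply: sumr_ge0 => p _; rewrite mulr_ge0 ?ler0n ?exprn_ge0.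
move=> X Y e e0 hX hY hXY; rewrite /determinant -sumrB mulr_suml.
apply: le_trans (ler_norm_sum _ _ _) _; apply: ler_sum => p _.
rewrite -mulrBr normrM normrX normrN1 expr1n mul1r.
exact: prod_lipschitz.
Qed.

(** Split p into linear factors. Each root z lies off [0, 1], so |t - z| is bounded below by |Im z|
    if z is not real, by -z if z < 0 and by z - 1 if z > 1; the bounds are multiplied. *)
Lemma horner_lower_bound (p : {poly C}) :
  (forall t : C, 0 <= t <= 1 -> p.[t] != 0) ->
  exists2 m : C, 0 < m & forall t : C, 0 <= t <= 1 -> m <= `|p.[t]|.
Proof.
move=> hp; have [r ep] := closed_field_poly_normal p.
have ev t : p.[t] = lead_coef p * \prod_(z <- r) (t - z).
  rewrite {1}ep hornerZ horner_prod; congr (_ * _).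
  by apply: eq_bigr => z _; rewrite hornerXsubC.
have hroot (t : C) : 0 <= t <= 1 -> t \notin r.
  move=> t01; apply/negP => tr; have := hp t t01; rewrite ev.
  by rewrite (big_rem t tr) /= subrr mul0r mulr0 eqxx.
have l0 : lead_coef p != 0.
  have := hp 0 (introT andP (conj (lexx 0) ler01)); rewrite ev.
  by apply: contra => /eqP ->; rewrite mul0r.
have dist (z : C) : (forall t : C, 0 <= t <= 1 -> t != z) ->
    exists2 m : C, 0 < m & forall t : C, 0 <= t <= 1 -> m <= `|t - z|.
  move=> hz; have [zR|zR] := boolP (z \is Num.real); last first.
    exists `|'Im z|.
      rewrite normr_gt0; apply: contra zR => /eqP i0.
      by apply/Creal_ReP; rewrite [RHS]Crect i0 mulr0 addr0.
    move=> t /andP[t0 _]; have <- : `|'Im (t - z)| = `|'Im z|.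
      by rewrite raddfB /= (Creal_ImP t _) ?ger0_real // sub0r normrN.
    rewrite -(@ler_pXn2r _ 2) ?nnegrE // [leRHS]normC2_Re_Im.
    by rewrite real_normK ?Creal_Im // lerDr real_exprn_even_ge0 // Creal_Re.
  have tR (t : C) : 0 <= t <= 1 -> t \is Num.real by case/andP=> t0 _; apply: ger0_real.
  have [z0|z0] := real_ltP zR (real0 _).
    exists (- z); first by rewrite oppr_gt0.
    move=> t /[dup] /tR tr /andP[t0 _]; apply: le_trans (real_ler_norm _) => //.
      by rewrite lerDr.
    by rewrite rpredB.
  have [z1|z1] := real_leP zR (real1 _); first by have := hz z; rewrite z0 z1 eqxx => /(_ isT).
  exists (z - 1); first by rewrite subr_gt0.
  move=> t /[dup] /tR tr /andP[_ t1]; rewrite distrC; apply: le_trans (real_ler_norm _).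
    by rewrite lerD2l lerN2.
  by rewrite rpredB.
have [m m0 hm] : exists2 m : C, 0 < m &
    forall t : C, 0 <= t <= 1 -> m <= `|\prod_(z <- r) (t - z)|.
  elim: r hroot {ep ev} => [|z r IH] hr.
    by exists 1; [exact: ltr01 | move=> t _; rewrite big_nil normr1].
  have [|m1 m10 h1] := IH; first by move=> t /hr; rewrite inE negb_or => /andP[].
  have [|m2 m20 h2] := dist z; first by move=> t /hr; rewrite inE negb_or => /andP[].
  exists (m2 * m1); first exact: mulr_gt0.
  move=> t t01; rewrite big_cons normrM; apply: ler_pM; [exact: ltW|exact: ltW|exact: h2|exact: h1].
exists (`|lead_coef p| * m); first by rewrite mulr_gt0 // normr_gt0.
by move=> t t01; rewrite ev normrM ler_wpM2l // hm.
Qed.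

(** Schur triangularization of N: the [e i] are the diagonal entries of the triangular form. *)
Lemma det_pencil_factor n (N : 'M[C]_n) : (0 < n)%N ->
  exists e : 'I_n -> C, forall a b, \det (a%:M + b *: N) = \prod_i (a + b * e i).
Proof.
move=> n0; have [P /unitarymx_unit Pu] := Schur N n0.
rewrite /similar_to conjumx // => tr; exists (fun i => (P *m N *m invmx P) i i) => a b.
have -> : \det (a%:M + b *: N) = \det (P *m (a%:M + b *: N) *m invmx P).
  by rewrite !det_mulmx mulrAC -det_mulmx mulmxV // det1 mul1r.
rewrite mulmxDr mulmxDl mul_mx_scalar -scalemxAl mulmxV // scalemx1.
rewrite -scalemxAr -scalemxAl det_trig.
  by apply: eq_bigr => i _; rewrite [LHS]mxE; congr (_ + _); [rewrite mxE eqxx mulr1n | rewrite mxE].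
apply/is_trig_mxP => i j ij; rewrite [LHS]mxE [X in X + _]mxE -val_eqE ltn_eqF // mulr0n add0r.
by rewrite mxE (is_trig_mxP tr) // mulr0.
Qed.

(** * Factorization of the characteristic form *)

Lemma charp_ext R K (T : tensor C R R K) g h : g =1 h -> charp T g = charp T h.
Proof. by move=> e; congr (\det _); apply: eq_bigr => k _; rewrite e. Qed.

Lemma charp_zero R K (T : tensor C R R K) g : (0 < R)%N -> (forall k, g k = 0) ->
  charp T g = 0.
Proof.
case: R T => // R T _ g0; rewrite /charp big1 ?det0 // => k _.
by rewrite g0 scale0r.
Qed.

(** In the basis [g], [h0] of C^2, with coordinates [a h] and [b h], the pencil at [h] is [M g]
    times a scalar matrix plus a multiple of one fixed matrix, so [det_pencil_factor] applies. *)
Lemma charp_factor n (T : tensor C n n 2) g : (0 < n)%N -> charp T g != 0 ->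
  exists (c : C) (mu : 'I_n -> 'I_2 -> C), (forall i, vnorm (mu i) = 1) /\
    forall h, charp T h = c * \prod_(i < n) \sum_(k < 2) mu i k * h k.
Proof.
move=> n0 cg; pose d := g 0 * (g 0)^* + g 1 * (g 1)^*.
have d0 : d != 0.
  apply: contra cg => /eqP d0; apply/eqP/charp_zero => //; apply: vnorm_eq0.
  by rewrite /vnorm sum_ord2 !normCK -/d d0 sqrtC0.
pose M h := \sum_(k < 2) h k *: T k.
have Mu : M g \in unitmx by rewrite unitmxE unitfE.
(* This vector is orthogonal to [g], and [d] is |g|^2. *)
pose h0 := perp (fun k => (g k)^*).
have [e he] := det_pencil_factor (invmx (M g) *m M h0) n0.
pose a (h : 'I_2 -> C) := ((g 0)^* * h 0 + (g 1)^* * h 1) / d.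
pose b (h : 'I_2 -> C) := (g 1 * h 0 - g 0 * h 1) / d.
have Mh (h : 'I_2 -> C) : M h = a h *: M g + b h *: M h0.
  rewrite /M !sum_ord2 !scalerDr !scalerA addrACA -!scalerDl.
  congr (_ *: _ + _ *: _); rewrite /a /b /h0 /perp /= /d; move: d0; rewrite /d => d0.
    by field.
  by field.
have ch h : charp T h = charp T g * \prod_(i < n) (a h + b h * e i).
  rewrite -he /charp -[\sum_k _ *: _ in LHS]/(M h) -[\sum_k _ *: _ in RHS]/(M g).
  rewrite -det_mulmx mulmxDr mul_mx_scalar -scalemxAr mulmxA mulmxV // mul1mx.
  by rewrite -Mh.
pose m i : 'I_2 -> C := fun k => if k == 0 then ((g 0)^* + g 1 * e i) / d
  else ((g 1)^* - g 0 * e i) / d.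
have mE i h : a h + b h * e i = \sum_(k < 2) m i k * h k.
  by rewrite sum_ord2 /m /= /a /b; field.
(* Each form takes the value 1 at [g], so it can be normalized; the norms go into the constant. *)
have mn i : exists k, m i k != 0.
  have : a g + b g * e i = 1.
    rewrite /a /b mulrC [g 1 * g 0]mulrC subrr mul0r mul0r addr0.
    by rewrite [X in _ * X](_ : _ = d) ?mulVf // /d; ring.
  rewrite mE sum_ord2; have [-> |] := eqVneq (m i 0) 0; last by exists 0.
  have [-> |] := eqVneq (m i 1) 0; last by exists 1.
  by rewrite !mul0r addr0 => /eqP; rewrite eq_sym oner_eq0.
exists (charp T g * \prod_i vnorm (m i)), (fun i k => (vnorm (m i))^-1 * m i k).
split=> [i|h]; first by have [k /vnorm_normalize[]] := mn i.
rewrite ch -mulrA -big_split /=; congr (_ * _); apply: eq_bigr => i _.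
have [k /vnorm_normalize[m0 _]] := mn i.
rewrite mE mulr_sumr; apply: eq_bigr => l _.
by rewrite !mulrA divff // mul1r.
Qed.

(** * The segment from T to W *)

Definition segment I J K (T W : tensor C I J K) (t : C) : tensor C I J K :=
  [ffun k => T k + t *: (W k - T k)].

Lemma segment0 I J K (T W : tensor C I J K) : segment T W 0 = T.
Proof. by apply/ffunP => k; rewrite ffunE scale0r addr0. Qed.

Lemma segment1 I J K (T W : tensor C I J K) : segment T W 1 = W.
Proof. by apply/ffunP => k; rewrite ffunE scale1r addrC subrK. Qed.

Lemma tensK_segment realK I J K (T W : tensor C I J K) t : 0 <= t ->
  tensK realK T -> tensK realK W -> tensK realK (segment T W t).
Proof.
move=> t0 hT hW k i j; rewrite ffunE !mxE.
apply: inKD; first exact: hT.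
apply: inKM; first by apply: inK_real; apply: ger0_real.
by apply: inKD; [apply: hW | apply: inKN; apply: hT].
Qed.

Lemma vnorm1_coord n (v : 'I_n -> C) k : vnorm v = 1 -> `|v k| <= 1.
Proof.
move=> v1; rewrite -(@ler_pXn2r _ 2) ?nnegrE // expr1n -[leRHS](expr1n _ 2) -v1 vnorm_sq.
by rewrite (bigD1 k) //= lerDl sumr_ge0 // => i _; rewrite exprn_ge0.
Qed.

(** [L] depends neither on [v] nor on the position along the segment, which is what permits steps of
    a fixed length. Entries of the combined slices are bounded by [a i j] and change by at most
    [a i j * |t - t'|]. *)
Lemma charp_segment_lipschitz n K (T W : tensor C n n K) : exists2 L : C, 0 <= L &
  forall (t t' : C) v, 0 <= t <= 1 -> 0 <= t' <= 1 -> vnorm v = 1 ->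
    `|charp (segment T W t) v - charp (segment T W t') v| <= L * `|t - t'|.
Proof.
pose a i j := \sum_(k < K) (`|T k i j| + `|W k i j - T k i j|).
have a0 i j : 0 <= a i j by apply: sumr_ge0 => k _; rewrite addr_ge0.
(* The summand 1 is there because [det_lipschitz] asks for a bound of at least 1. *)
pose b := 1 + \sum_i \sum_j a i j.
have b1 : 1 <= b by rewrite lerDl; do 2 (apply: sumr_ge0 => ? _).
have ab i j : a i j <= b.
  rewrite /b (bigD1 i) //= (bigD1 j) //= addrCA -!addrA lerDl.
  rewrite !addr_ge0 //; first by apply: sumr_ge0.
  by do 2 (apply: sumr_ge0 => ? _).
have [L L0 hL] := @det_lipschitz n b b1.
have bnd (t : C) v i j : 0 <= t <= 1 -> vnorm v = 1 ->
    `|(\sum_(k < K) v k *: segment T W t k) i j| <= b.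
  move=> /andP[t0 t1] v1; apply: le_trans (ab i j).
  rewrite summxE; apply: le_trans (ler_norm_sum _ _ _) _; apply: ler_sum => k _.
  rewrite ffunE !mxE normrM.
  apply: le_trans (ler_piMl _ (vnorm1_coord k v1)) _ => //.
  apply: le_trans (ler_normD _ _) _; rewrite lerD2l normrM ger0_norm //.
  by rewrite ler_piMl.
exists (L * b); first by rewrite mulr_ge0 // (le_trans _ b1).
move=> t t' v ht ht' v1; rewrite -mulrA; apply: hL.
- by rewrite mulr_ge0 // (le_trans _ b1).
- by move=> i j; apply: bnd.
- by move=> i j; apply: bnd.
move=> i j; rewrite !summxE -sumrB; apply: le_trans (ler_norm_sum _ _ _) _.
apply: (@le_trans _ _ (a i j * `|t - t'|)); last by rewrite ler_wpM2r.
rewrite mulr_suml; apply: ler_sum => k _; rewrite !ffunE !mxE.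
have -> : v k * (T k i j + t * (W k i j - T k i j)) -
  v k * (T k i j + t' * (W k i j - T k i j)) = v k * ((W k i j - T k i j) * (t - t')).
  ring.
rewrite normrM; apply: le_trans (ler_piMl _ (vnorm1_coord k v1)) _ => //.
by rewrite normrM ler_wpM2r // lerDr.
Qed.

(** For fixed [g] the characteristic form along the segment is a polynomial in t without zeros in
    [0, 1]. *)
Lemma charp_segment_lower_bound n K (T W : tensor C n n K) g :
  (forall t : C, 0 <= t <= 1 -> charp (segment T W t) g != 0) ->
  exists2 m : C, 0 < m & forall t : C, 0 <= t <= 1 -> m <= `|charp (segment T W t) g|.
Proof.
move=> h; pose X := \sum_k g k *: T k; pose Y := \sum_k g k *: (W k - T k).
pose p := \det (\matrix_(i, j) ((X i j)%:P + 'X * (Y i j)%:P)).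
have pE t : charp (segment T W t) g = p.[t].
  rewrite -horner_evalE -det_map_mx; congr (\det _); apply/matrixP => i j.
  rewrite !mxE /= horner_evalE !hornerE !summxE mulr_sumr -big_split /=.
  by apply: eq_bigr => k _; rewrite ffunE !mxE; ring.
have [|m m0 hm] := @horner_lower_bound p; first by move=> t /h; rewrite pE.
by exists m => // t /hm; rewrite pE.
Qed.

(** * Singular values *)

Definition nsq n (x : 'cV[C]_n) : C := \sum_i `|x i 0| ^+ 2.

Lemma nsqE n (x : 'cV[C]_n) : nsq x = (adjmx x *m x) 0 0.
Proof. by rewrite mxE; apply: eq_bigr => i _; rewrite normCK !mxE mulrC. Qed.

Lemma nsq_ge0 n (x : 'cV[C]_n) : 0 <= nsq x.
Proof. by apply: sumr_ge0 => i _; rewrite exprn_ge0. Qed.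

Lemma nsq_eq0 n (x : 'cV[C]_n) : nsq x = 0 -> x = 0.
Proof.
move=> /psumr_eq0P => /(_ (fun i _ => exprn_ge0 _ (normr_ge0 _))) h.
apply/matrixP => i j; rewrite ord1 mxE; have /eqP := h i isT.
by rewrite expf_eq0 /= normr_eq0 => /eqP.
Qed.

Lemma adjmx_mul m n p (A : 'M[C]_(m, n)) (B : 'M[C]_(n, p)) :
  adjmx (A *m B) = adjmx B *m adjmx A.
Proof. by rewrite /adjmx map_mxM trmx_mul. Qed.

Lemma adjmxK m n (A : 'M[C]_(m, n)) : adjmx (adjmx A) = A.
Proof. by apply/matrixP => i j; rewrite !mxE conjCK. Qed.

(** The Gram matrix is normal, hence diagonal in a unitary basis [P]. There |A x|^2 is a sum of
    squares weighted by eigenvalues, all at least [c], and [P] preserves the norm. *)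
Lemma gram_lower_bound m n (A : 'M[C]_(m, n)) (c : C) :
  (forall e, eigenvalue (adjmx A *m A) e -> c <= e) ->
  forall x, c * nsq x <= nsq (A *m x).
Proof.
move=> hc x; set H := adjmx A *m A in hc.
have tc p q (Z : 'M[C]_(p, q)) : (Z ^t* )%sesqui = adjmx Z by rewrite /adjmx map_trmx.
have Hn : H \is normalmx.
  by apply/normalmxP; rewrite tc /H adjmx_mul adjmxK.
have /orthomx_spectralP := Hn; set P := spectralmx H; set d := spectral_diag H.
have Pu : P \is unitarymx by apply: spectral_unitarymx.
have Pun := unitarymx_unit Pu.
rewrite invmx_unitary // tc => HE.
have PP : adjmx P *m P = 1%:M by rewrite -tc -invmx_unitary // mulVmx.
(* The rows of [P] are left eigenvectors, as [eigenvalue] requires, and they are nonzero because [P]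
   is unitary. *)
have dc i : c <= d 0 i.
  apply: hc; apply/eigenvalueP; exists (row i P).
    have PH : P *m H = diag_mx d *m P.
      by rewrite HE !mulmxA -tc -invmx_unitary // mulmxV // mul1mx.
    by rewrite -row_mul PH row_mul row_diag_mx -scalemxAl -rowE.
  apply/negP => /eqP r0; have := unitarymxP Pu => /matrixP/(_ i i).
  rewrite mxE big1 => [|k _]; first by rewrite mxE eqxx => /eqP; rewrite eq_sym oner_eq0.
  by have /rowP/(_ k) := r0; rewrite !mxE => ->; rewrite mul0r.
have -> : nsq x = nsq (P *m x).
  by rewrite !nsqE adjmx_mul -mulmxA [adjmx P *m _]mulmxA PP mul1mx.
have -> : nsq (A *m x) = \sum_i d 0 i * `|(P *m x) i 0| ^+ 2.
  rewrite nsqE adjmx_mul -mulmxA [adjmx A *m _]mulmxA -/H HE -!mulmxA mulmxA -adjmx_mul.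
  rewrite mxE; apply: eq_bigr => i _; rewrite mul_diag_mx normCK !mxE; ring.
by rewrite mulr_sumr; apply: ler_sum => i _; rewrite ler_wpM2r // exprn_ge0.
Qed.

Lemma sigma_min_lower_bound n (A : 'M[C]_n) s : is_sigma_min A s ->
  forall x, s ^+ 2 * nsq x <= nsq (A *m x).
Proof. by case=> _ _ h; apply: gram_lower_bound. Qed.

Lemma sigma_min_unitmx n (A : 'M[C]_n) s : is_sigma_min A s -> s != 0 -> A \in unitmx.
Proof.
move=> hA s0; rewrite -unitmx_tr -row_free_unit -kermx_eq0.
apply/rowV0P => v /sub_kermxP vA.
have := sigma_min_lower_bound hA v^T; rewrite -[A]trmxK -trmx_mul vA.
have -> : nsq (0^T : 'cV[C]_n) = 0 by rewrite /nsq big1 // => i _; rewrite !mxE normr0 expr0n.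
have s2 : 0 < s ^+ 2 by case: hA => sp _ _; rewrite exprn_gt0 // lt_def s0.
rewrite pmulr_rle0 // => le0; apply: trmx_inj; rewrite trmx0.
by apply: nsq_eq0; apply/eqP; rewrite eq_le le0 nsq_ge0.
Qed.

(** Sending v to [v *m A] carries left eigenvectors of [A *m adjmx A] to left eigenvectors of
    [adjmx A *m A], injectively since A is invertible; so the eigenvalue bound passes to the
    transpose. *)
Lemma sigma_min_lower_bound_tr n (A : 'M[C]_n) s : is_sigma_min A s -> s != 0 ->
  forall x, s ^+ 2 * nsq x <= nsq (A^T *m x).
Proof.
move=> hA s0; have Au := sigma_min_unitmx hA s0; case: hA => _ _ h.
apply: gram_lower_bound => e he; apply: h; move: he.
have -> : adjmx A^T *m A^T = (A *m adjmx A)^T.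
  by rewrite trmx_mul /adjmx trmxK map_trmx trmxK.
have -> : eigenvalue (A *m adjmx A)^T e = eigenvalue (A *m adjmx A) e.
  rewrite !eigenvalue_root_char /char_poly -[in RHS]det_tr; congr (root (\det _) e).
  by apply/matrixP => i j; rewrite !mxE eq_sym.
case/eigenvalueP => v ve v0; apply/eigenvalueP; exists (v *m A).
  by rewrite mulmxA -[v *m A *m _]mulmxA ve -scalemxAl.
apply: contra v0 => /eqP vA; apply/eqP.
by rewrite -[v](mulmxK Au) vA mul0mx.
Qed.

End Estimates.

(** * Localization of the roots *)

Section Localization.
Variable C : numClosedFieldType.
Implicit Types (realK : bool).

Lemma spnorm_ge0 realK I J K (M : tensor C I J K) s : is_spnorm realK M s -> 0 <= s.
Proof. by case=> _ [x [y [z [_ _ _ <-]]]]. Qed.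

(** Contract with the conjugate of y = E x, with x and with v, the first two normalized: the value
    is |y| / |x|. *)
Lemma spnorm_slice_bound realK I J K (M : tensor C I J K) s v (x : 'cV[C]_J) :
  is_spnorm realK M s -> tensK realK M -> unitK realK v -> mxK realK x ->
  nsq ((\sum_(k < K) v k *: M k) *m x) <= s ^+ 2 * nsq x.
Proof.
move=> hs hM hv hx; have s0 := spnorm_ge0 hs.
set E := \sum_k _; set y := E *m x.
have hy : mxK realK y.
  apply: mxK_mul => // i j; rewrite summxE; apply: inK_sum => k; rewrite mxE.
  by apply: inKM; [apply: hv.1 | apply: hM].
have [y0|y0] := eqVneq (nsq y) 0.
  by rewrite y0 mulr_ge0 ?nsq_ge0 // exprn_ge0.
have x0 : nsq x != 0.
  by apply: contra y0 => /eqP/nsq_eq0 x0; rewrite /y x0 mulmx0 /nsq big1 // => i _; rewrite mxE normr0 expr0n.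
pose a := sqrtC (nsq x); pose b := sqrtC (nsq y).
have a0 : 0 < a by rewrite sqrtC_gt0 lt_def x0 nsq_ge0.
have b0 : 0 < b by rewrite sqrtC_gt0 lt_def y0 nsq_ge0.
have unit1 n (z : 'cV[C]_n) : nsq z != 0 ->
    vnorm (fun i => z i 0 / sqrtC (nsq z)) = 1.
  move=> z0; rewrite (vnormZ (a := (sqrtC (nsq z))^-1) (u := fun i => z i 0)); last first.
    by move=> k; rewrite mulrC.
  rewrite /vnorm -/(nsq z) ger0_norm ?invr_ge0 ?sqrtC_ge0 ?nsq_ge0 // mulVf //.
  by rewrite sqrtC_eq0.
have hx' : unitK realK (fun j => x j 0 / a).
  split; last exact: unit1.
  by move=> j; apply: inKM => //; apply/inKV/inK_real/gtr0_real.
have hy' : unitK realK (fun j => (y j 0)^* / b).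
  split.
    by move=> j; apply: inKM; [exact: inK_conj | apply/inKV/inK_real/gtr0_real].
  rewrite -[RHS](unit1 _ y y0) /vnorm; congr sqrtC; apply: eq_bigr => i _.
  by rewrite !normrM norm_conjC.
have := hs.1 _ _ _ hy' hx' hv.
have -> : contract M (fun j => (y j 0)^* / b) (fun j => x j 0 / a) v = b / a.
  rewrite /contract; transitivity (\sum_i (y i 0)^* / b * (y i 0 / a)).
    apply: eq_bigr => i _; rewrite {3}/y mxE mulr_suml mulr_sumr; apply: eq_bigr => j _.
    rewrite /E summxE !mulr_suml mulr_sumr; apply: eq_bigr => k _; rewrite mxE; ring.
  have bb : b * b = nsq y by rewrite -expr2 sqrtCK.
  transitivity (nsq y / b / a); last by rewrite -bb mulfK // gt_eqF.
  rewrite /nsq !mulr_suml; apply: eq_bigr => i _; rewrite normCK; ring.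
rewrite (ger0_norm (divr_ge0 (ltW b0) (ltW a0))) ler_pdivrMr // => le.
rewrite -(sqrtCK (nsq y)) -(sqrtCK (nsq x)) -exprMn.
by rewrite ler_pXn2r ?nnegrE ?(mulr_ge0 s0) ?(ltW a0) ?(ltW b0).
Qed.

Lemma cpd_comb I J K F (A : 'M[C]_(I, F)) (B : 'M[C]_(J, F)) (Cm : 'M[C]_(K, F)) g :
  \sum_(k < K) g k *: cpd A B Cm k =
  A *m diag_mx (\row_r \sum_(k < K) Cm k r * g k) *m B^T.
Proof.
apply/matrixP => i j; rewrite summxE mul_mx_diag mxE.
under eq_bigr do rewrite ffunE !mxE mulr_sumr.
rewrite exchange_big /=; apply: eq_bigr => r _; rewrite !mxE mulr_sumr mulr_suml.
by apply: eq_bigr => k _; ring.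
Qed.

Lemma charp_cpd n K (A B : 'M[C]_n) (Cm : 'M[C]_(K, n)) g :
  charp (cpd A B Cm) g = \det A * \det B * \prod_(r < n) \sum_(k < K) Cm k r * g k.
Proof.
rewrite /charp cpd_comb !det_mulmx det_tr det_diag mulrAC; congr (_ * _).
by apply: eq_bigr => r _; rewrite mxE.
Qed.

(** By contradiction, with a kernel vector x: A D y = t E x, where y = B^T x, D is diagonal with the
    wedges of the columns with [v], and E combines the slices of T - W. The singular value bounds
    give |D y| <= eps |y|; if all diagonal entries exceed [eps], then y = 0 and x = 0. *)
Lemma bauer_fike realK n (T W : tensor C n n 2) (A B : 'M[C]_n) (Cm : 'M[C]_(2, n))
    (sA sB s t : C) v :
  tensK realK T -> tensK realK W -> T = cpd A B Cm ->
  is_sigma_min A sA -> is_sigma_min B sB -> sA != 0 -> sB != 0 ->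
  is_spnorm realK (tsub T W) s -> 0 <= t <= 1 -> unitK realK v ->
  charp (segment T W t) (perp v) = 0 ->
  exists r, `|wedge (fun k => Cm k r) v| <= s / (sA * sB).
Proof.
move=> hT hW eT hA hB A0 B0 hs /andP[t0 t1] hv c0; have s0 := spnorm_ge0 hs.
have sAp : 0 < sA by case: hA => ? _ _; rewrite lt_def A0.
have sBp : 0 < sB by case: hB => ? _ _; rewrite lt_def B0.
set eps := s / _; have e0 : 0 <= eps by rewrite (divr_ge0 s0) // ltW // mulr_gt0.
have [/existsP//|] := boolP [exists r, `|wedge (fun k => Cm k r) v| <= eps].
rewrite negb_exists => /forallP hr.
have hp : unitK realK (perp v) by split; [apply/vecK_perp/hv.1 | rewrite vnorm_perp hv.2].
have hseg := tensK_segment t0 hT hW.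
(* The kernel vector has to lie over K because [s] only controls contractions with vectors of K. *)
have [x [xK x0 Mx]] := mxK_kernel (mxK_comb hseg hp.1) c0.
have hE : tensK realK (tsub T W).
  by move=> k i j; rewrite ffunE !mxE; apply: inKD; [apply: hT | apply/inKN/hW].
have le1 := spnorm_slice_bound hs hE hp xK.
pose E := \sum_(k < 2) perp v k *: tsub T W k.
have ET : (\sum_(k < 2) perp v k *: T k) *m x = t *: (E *m x).
  apply/eqP; rewrite -subr_eq0 scalemxAl -mulmxBl -Mx; apply/eqP; congr (_ *m _).
  rewrite /E scaler_sumr -sumrB; apply: eq_bigr => k _.
  by rewrite !ffunE !scalerA !scalerDr !scalerN !scalerA [t * _]mulrC opprB addrA addrAC -addrA.
pose y := B^T *m x; pose d := \row_r wedge (fun k => Cm k r) v.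
have ET' : A *m (diag_mx d *m y) = t *: (E *m x).
  rewrite -ET {1}eT cpd_comb -!mulmxA; congr (A *m (diag_mx _ *m _)).
  by apply/rowP => r; rewrite !mxE form_perp.
have le2 : sA ^+ 2 * nsq (diag_mx d *m y) <= s ^+ 2 * nsq x.
  apply: le_trans (sigma_min_lower_bound hA _) _; rewrite ET'.
  apply: le_trans le1; rewrite -/E.
  have -> : nsq (t *: (E *m x)) = t ^+ 2 * nsq (E *m x).
    by rewrite /nsq mulr_sumr; apply: eq_bigr => i _; rewrite mxE normrM exprMn ger0_norm.
  by rewrite ler_piMl ?nsq_ge0 // exprn_ile1.
have le3 := sigma_min_lower_bound_tr hB B0 x; rewrite -/y in le3.
have le4 : nsq (diag_mx d *m y) <= eps ^+ 2 * nsq y.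
  rewrite -(ler_pM2l (exprn_gt0 2 sAp)); apply: le_trans le2 _.
  rewrite mulrA -exprMn.
  have -> : s ^+ 2 * nsq x = (sA * eps) ^+ 2 * (sB ^+ 2 * nsq x).
    by rewrite /eps; field; rewrite A0 B0.
  by rewrite ler_wpM2l // exprn_ge0 // mulr_ge0 // ltW.
have dlt i : eps ^+ 2 < `|d 0 i| ^+ 2.
  by rewrite ltr_pXn2r ?nnegrE // mxE real_ltNge ?hr // ger0_real.
have term_ge0 i : 0 <= (`|d 0 i| ^+ 2 - eps ^+ 2) * `|y i 0| ^+ 2.
  by rewrite mulr_ge0 ?exprn_ge0 // subr_ge0 ltW.
have sum0 : \sum_i (`|d 0 i| ^+ 2 - eps ^+ 2) * `|y i 0| ^+ 2 = 0.
  apply/eqP; rewrite eq_le sumr_ge0 // andbT.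
  under eq_bigr do rewrite mulrBl.
  rewrite sumrB subr_le0 -mulr_sumr; apply: le_trans le4; rewrite le_eqVlt; apply/orP; left.
  by apply/eqP/eq_bigr => i _; rewrite [in RHS]mul_diag_mx [in RHS]mxE normrM exprMn.
have y0 : y = 0.
  apply/matrixP => i j; rewrite ord1 [RHS]mxE.
  have /eqP := psumr_eq0P (fun i _ => term_ge0 i) sum0 (i := i) isT.
  by rewrite mulf_eq0 subr_eq0 (gt_eqF (dlt i)) /= expf_eq0 /= normr_eq0 => /eqP.
case/negP: x0; apply/eqP/nsq_eq0/eqP; rewrite eq_le nsq_ge0 andbT.
move: le3; rewrite y0 /nsq [in leRHS]big1 => [|i _]; last by rewrite mxE normr0 expr0n.
by rewrite pmulr_rle0 // exprn_gt0.
Qed.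

Lemma charp_conj n K (T : tensor C n n K) g : tensK true T ->
  charp T (fun k => (g k)^*) = (charp T g)^*.
Proof.
move=> hT; rewrite /charp -det_map_mx; congr (\det _); apply/matrixP => i j.
rewrite mxE !summxE rmorph_sum; apply: eq_bigr => k _.
by rewrite !mxE rmorphM /= (conj_Creal (hT k i j)).
Qed.

(** Rotate [c] towards the orthogonal unit vector [d], with sine [rho] and cosine [sg]. *)
Lemma unitK_at_distance realK (c : 'I_2 -> C) rho : unitK realK c -> 0 <= rho <= 1 ->
  exists2 l, unitK realK l & `|wedge c l| = rho.
Proof.
move=> [cK c1] /andP[r0 r1]; pose sg := sqrtC (1 - rho ^+ 2).
have sg0 : 0 <= sg by rewrite sqrtC_ge0 subr_ge0 exprn_ile1.
pose d : 'I_2 -> C := fun k => if k == 0 then - (c 1)^* else (c 0)^*.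
have cc : c 0 * (c 0)^* + c 1 * (c 1)^* = 1.
  by rewrite -!normCK -(sum_ord2 (fun k => `|c k| ^+ 2)) -vnorm_sq c1 expr1n.
exists (fun k => sg * c k + rho * d k); last first.
  rewrite /wedge /d /= (_ : _ - _ = rho * (c 0 * (c 0)^* + c 1 * (c 1)^*)); last by ring.
  by rewrite cc mulr1 ger0_norm.
split.
  move=> k; apply: inKD; apply: inKM => //; try by apply/inK_real/ger0_real.
  by move: k; apply: ord2P; rewrite /d /=; [apply/inKN/inK_conj|apply/inK_conj].
apply: vnorm_sq1; rewrite sum_ord2 /d /= !normCK !rmorphD !rmorphM !rmorphN /= !conjCK.
rewrite (conj_Creal (ger0_real sg0)) (conj_Creal (ger0_real r0)).
transitivity ((sg ^+ 2 + rho ^+ 2) * (c 0 * (c 0)^* + c 1 * (c 1)^*)); first by ring.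
by rewrite cc mulr1 sqrtCK subrK.
Qed.

Lemma strict_lower_bound (a : C) (r : seq C) : a \is Num.real ->
  (forall x, x \in r -> x \is Num.real /\ a < x) ->
  exists2 b, a < b & forall x, x \in r -> b <= x.
Proof.
move=> aR; elim: r => [|y r IH] h.
  by exists (a + 1) => //; rewrite ltrDl.
have [|b ab hb] := IH; first by move=> x xr; apply: h; rewrite inE xr orbT.
have [yR ay] := h y (mem_head _ _).
have bR : b \is Num.real by rewrite -(subrK a b) rpredD // gtr0_real // subr_gt0.
have [yb|by_] := real_leP yR bR.
  exists y => // x; rewrite inE => /orP[/eqP->//|/hb]; exact: le_trans.
by exists b => // x; rewrite inE => /orP[/eqP->|/hb//]; apply: ltW.
Qed.

(** * Following the roots along the segment *)

Section Homotopy.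
Variables (realK : bool) (n : nat) (T W : tensor C n n 2) (c : 'I_n -> 'I_2 -> C).
Variables (eps G : C).
Hypothesis n_gt1 : (1 < n)%N.
Hypothesis archi : forall x : C, 0 <= x -> exists N : nat, x < N%:R.
Hypotheses (TK : tensK realK T) (WK : tensK realK W).
Hypothesis cK : forall r, unitK realK (c r).
Hypothesis eps_ge0 : 0 <= eps.
Hypothesis gap : eps + eps < G.
Hypothesis gapP : forall i j, i != j -> G <= `|wedge (c i) (c j)|.
Hypothesis T_root : forall r, charp T (perp (c r)) = 0.
Hypothesis localization : forall (t : C) v, 0 <= t <= 1 -> unitK realK v ->
  charp (segment T W t) (perp v) = 0 -> exists r, `|wedge (c r) v| <= eps.

Let n_gt0 : (0 < n)%N := ltnW n_gt1.

(** A vector at distance exactly [G / 2] from one column is farther than [eps] from it and, by the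
    triangle inequality, from every other column; localization then excludes it as a root for all t
    at once. *)
Lemma nonroot_exists : exists2 l, unitK realK l &
  forall t : C, 0 <= t <= 1 -> charp (segment T W t) (perp l) != 0.
Proof.
pose i0 : 'I_n := Ordinal n_gt0; pose i1 : 'I_n := Ordinal n_gt1.
have G0 : 0 < G by apply: le_lt_trans gap; rewrite addr_ge0.
have G1 : G <= 1.
  by apply: le_trans (gapP (i := i0) (j := i1) isT) _; apply: wedge_le1; apply: (cK _).2.
have rho01 : 0 <= G / 2 <= 1.
  rewrite divr_ge0 ?(ltW G0) //= ler_pdivrMr // mul1r; apply: le_trans G1 _.
  by rewrite ler1n.
have [l lK hl] := unitK_at_distance (cK i0) rho01; exists l => // t t01.
have epsG : eps < G / 2 by rewrite ltr_pdivlMr // mulrDr mulr1.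
apply/negP => /eqP /(localization t01 lK) [r].
have [->|ri] := eqVneq r i0.
  by rewrite hl => h; have := lt_le_trans epsG h; rewrite ltxx.
move=> h; have : G < G.
  apply: le_lt_trans (gapP ri) _.
  apply: le_lt_trans (wedge_triangle (cK r).2 (cK i0).2 lK.2) _.
  rewrite (norm_wedgeC l) hl [ltRHS](splitr G) ltrD2r; exact: le_lt_trans h epsG.
by rewrite ltxx.
Qed.

Definition rooted (t : C) := forall r, exists v,
  [/\ unitK realK v, `|wedge (c r) v| <= eps & charp (segment T W t) (perp v) = 0].

(** [L] bounds the change of the characteristic form between [t] and [t'], and [del] is room left by
    the gap. Each old root then has a linear factor of the new form within [del], and the gap makes
    this assignment injective. *)
Lemma rooted_step (L m del t t' : C) l :
  0 < m -> 0 < del -> eps + eps + (del + del) < G -> unitK realK l ->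
  0 <= t <= 1 -> 0 <= t' <= 1 ->
  m <= `|charp (segment T W t') (perp l)| ->
  (forall v, vnorm v = 1 -> `|charp (segment T W t) v - charp (segment T W t') v| <= L) ->
  L < del ^+ n * m -> rooted t -> rooted t'.
Proof.
move=> m0 del0 delG lK t01 t01' hm hL Lsmall /fin_all_exists [v hv].
have vK r : unitK realK (v r) by case: (hv r).
have vc r : `|wedge (v r) (c r)| <= eps by case: (hv r) => _ + _; rewrite norm_wedgeC.
have v0 r : charp (segment T W t) (perp (v r)) = 0 by case: (hv r).
have cl : charp (segment T W t') (perp l) != 0.
  by rewrite -normr_eq0 gt_eqF // (lt_le_trans m0).
have [ka [mu [mu1 chE]]] := charp_factor n_gt0 cl.
have chP u : charp (segment T W t') (perp u) = ka * \prod_(i < n) wedge (mu i) u.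
  by rewrite chE; congr (_ * _); apply: eq_bigr => i _; rewrite form_perp.
(* Every factor at the unit vector [l] is at most 1 in modulus, so the lower bound at [l] passes to
   [ka]. *)
have ka_m : m <= `|ka|.
  apply: le_trans hm _; rewrite chP normrM ler_piMr // normr_prod.
  by apply: prodr_ile1 => i _; rewrite normr_ge0 wedge_le1 // lK.2.
have ka0 : ka != 0 by rewrite -normr_eq0 gt_eqF // (lt_le_trans m0).
(* Otherwise all n factors exceed [del] at [v r] and the new value there is at least [del ^+ n * m];
   it is at most [L], because [v r] was a root at [t]. *)
have near r : exists i, `|wedge (mu i) (v r)| <= del.
  have [/existsP//|] := boolP [exists i, `|wedge (mu i) (v r)| <= del].
  rewrite negb_exists => /forallP far.
  have : del ^+ n * m < del ^+ n * m.
    apply: le_lt_trans Lsmall.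
    have v1 : vnorm (perp (v r)) = 1 by rewrite vnorm_perp (vK r).2.
    apply: le_trans (hL _ v1); rewrite v0 sub0r normrN chP normrM mulrC.
    apply: ler_pM => //; [exact: ltW | by rewrite exprn_ge0 // ltW |].
    rewrite normr_prod -[n in del ^+ n]card_ord -prodr_const; apply: ler_prod => i _.
    by rewrite ltW //= ltW // real_ltNge ?far // gtr0_real.
  by rewrite ltxx.
have [f hf] := fin_all_exists near.
(* Old roots in different discs are more than [del + del] apart, so no unit vector is within [del]
   of two of them. *)
have close r q : `|wedge (v r) (v q)| <= del + del -> r = q.
  move=> h; apply/eqP; apply: contraTT isT => rq; have : G < G.
    apply: le_lt_trans (gapP rq) _; apply: le_lt_trans delG.
    apply: le_trans (wedge_triangle (cK r).2 (cK q).2 (vK r).2) _.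
    rewrite -addrA; apply: lerD; first by rewrite norm_wedgeC.
    apply: le_trans (wedge_triangle (vK r).2 (cK q).2 (vK q).2) _.
    by rewrite addrC lerD.
  by rewrite ltxx.
have sep u r q : vnorm u = 1 -> `|wedge u (v r)| <= del -> `|wedge u (v q)| <= del -> r = q.
  move=> u1 hr hq; apply: close.
  apply: le_trans (wedge_triangle (vK r).2 (vK q).2 u1) _.
  by rewrite lerD // norm_wedgeC.
have f_inj : injective f.
  by move=> r q e; apply: (sep (mu (f r))) => //; rewrite e.
(* An injection of a finite set into itself is onto, so every factor is near exactly one old
   root. *)
have [f' f'K fK] := injF_bij f_inj.
move=> r; have wmm := wedgexx (mu (f r)).
(* The conjugate of [mu (f r)] is again a root of the real form, hence proportional to some [mu j].
   Conjugation fixes [v r], so [mu j] is also near [v r], and uniqueness gives j = f r. *)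
have conj0 : realK -> wedge (mu (f r)) (fun k => (mu (f r) k)^*) = 0.
  move=> rK; set mub := fun k => _.
  have wconj u w : wedge (fun k => (u k)^*) (fun k => (w k)^*) = (wedge u w)^*.
    by rewrite /wedge rmorphB !rmorphM.
  have mub1 : vnorm mub = 1.
    rewrite -[RHS](mu1 (f r)) /vnorm; congr sqrtC.
    by apply: eq_bigr => k _; rewrite norm_conjC.
  have segR : tensK true (segment T W t').
    by rewrite -rK; apply: tensK_segment => //; case/andP: t01'.
  have /eqP : charp (segment T W t') (perp mub) = 0.
    rewrite (@charp_ext _ _ _ _ _ (fun k => (perp (mu (f r)) k)^*)); last first.
      by apply: ord2P; rewrite /perp /mub //= rmorphN.
    by rewrite charp_conj // chP (bigD1 (f r)) //= wmm mul0r mulr0 rmorph0.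
  rewrite chP mulf_eq0 (negPf ka0) /= => /prodf_eq0 [j _ /eqP wj].
  suff -> : f r = j by [].
  rewrite -[j]fK; congr f; apply: (sep (mu j)) => //; last by rewrite -{1}[j]fK.
  apply: le_trans (wedge_triangle (mu1 j) (vK r).2 mub1) _.
  rewrite wj normr0 add0r.
  have -> : wedge mub (v r) = wedge mub (fun k => (v r k)^*).
    have vR k : (v r k)^* = v r k by apply: conj_Creal; have := (vK r).1 k; rewrite rK.
    by rewrite /wedge !vR.
  by rewrite wconj norm_conjC.
have [u [a [uK a1 ua]]] := unitK_phase (mu1 (f r)) conj0.
have u0 : charp (segment T W t') (perp u) = 0.
  rewrite chP (bigD1 (f r)) //= wedgeC (wedgeZ _ ua) wmm mulr0 oppr0 mul0r mulr0 //.
(* Nearness to [v r] alone only yields distance [eps + del] from [c r]. Localization puts [u] within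
   [eps] of some column, and the gap forces that column to be [c r], so the radius does not grow. *)
exists u; split=> //; have [q hq] := localization t01' uK u0.
suff <- : q = r by [].
apply/eqP; apply: contraTT isT => qr; have : G < G.
  apply: le_lt_trans (gapP qr) _; apply: le_lt_trans delG.
  apply: le_trans (wedge_triangle (cK q).2 (cK r).2 uK.2) _.
  rewrite -addrA; apply: lerD => //.
  apply: le_trans (wedge_triangle uK.2 (cK r).2 (vK r).2) _.
  rewrite addrC; apply: lerD => //; rewrite (wedgeZ _ ua) normrM a1 mul1r.
  by apply: le_trans (hf r) _; rewrite lerDl ltW.
by rewrite ltxx.
Qed.

(** Go from 0 to 1 in [N] equal steps. The constants [m], [L] and [del] serve the whole segment, so
    a single [N], given by the archimedean property, suffices. *)
Lemma rooted1 : rooted 1.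
Proof.
have [l lK hl] := nonroot_exists.
have [m m0 hm] := charp_segment_lower_bound hl.
have [L L0 hL] := charp_segment_lipschitz T W.
(* Dividing by 4 makes [del + del] use only half of the slack, so that [delG] is strict. *)
pose del := (G - (eps + eps)) / 4.
have del0 : 0 < del by rewrite divr_gt0 // subr_gt0.
have delG : eps + eps + (del + del) < G.
  rewrite -ltrBrDl -mulrDl ltr_pdivrMr // -mulr2n -[_ *+ 2]mulr_natr ltr_pM2l ?subr_gt0 //.
  by rewrite ltr_nat.
have dm0 : 0 < del ^+ n * m by rewrite mulr_gt0 // exprn_gt0.
have [N hN] := archi (divr_ge0 L0 (ltW dm0)).
have N0 : 0 < N%:R :> C by apply: le_lt_trans hN; rewrite divr_ge0 // ltW.
have Lsmall : L * N%:R^-1 < del ^+ n * m.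
  by rewrite ltr_pdivrMr // mulrC -ltr_pdivrMr.
have main k : (k <= N)%N -> rooted (k%:R / N%:R).
  have in01 j : (j <= N)%N -> 0 <= j%:R / N%:R :> C /\ j%:R / N%:R <= 1 :> C.
    move=> jN; rewrite divr_ge0 ?ler0n // ler_pdivrMr // mul1r ler_nat //.
  elim: k => [_|k IH kN].
    move=> r; exists (c r); split=> //; last by rewrite mul0r segment0.
    by rewrite wedgexx normr0.
  have /andP t1 := in01 _ kN; have /andP t0 := in01 _ (ltnW kN).
  apply: (rooted_step m0 del0 delG lK t0 t1 (hm _ t1) _ Lsmall (IH (ltnW kN))) => v v1.
  apply: le_trans (hL _ _ _ t0 t1 v1) _; rewrite ler_wpM2l //.
  by rewrite -mulrBl -natr1 opprD addNKr normrM normrN1 mul1r ger0_norm ?invr_ge0 // ltW.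
by have := main N (leqnn N); rewrite divff // gt_eqF.
Qed.

End Homotopy.

End Localization.

(** * From roots to the tensor *)

Section Roots.
Variable C : numClosedFieldType.
Implicit Types (realK : bool).

(** Each root annihilates some linear factor, which is then proportional to it; pairwise independent
    roots use different factors, so n roots account for all n factors. *)
Lemma roots_match n (T : tensor C n n 2) g (ka : C) (lam v : 'I_n -> 'I_2 -> C) :
  charp T g != 0 ->
  (forall h, charp T h = ka * \prod_(i < n) \sum_(k < 2) lam i k * h k) ->
  (forall r, vnorm (v r) = 1) -> (forall r q, r != q -> wedge (v r) (v q) != 0) ->
  (forall r, charp T (perp (v r)) = 0) ->
  exists p : 'S_n, forall r, exists2 a : C, a != 0 & forall k, lam (p r) k = a * v r k.
Proof.
move=> cg ch v1 vw v0.
have ka0 : ka != 0 by apply: contra cg => /eqP ka0; rewrite ch ka0 mul0r.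
have lam0 i : ~ (forall k, lam i k = 0).
  move=> e; case/negP: cg; rewrite ch (bigD1 i) //= big1 ?mul0r ?mulr0 // => k _.
  by rewrite e mul0r.
have ex r : exists i, wedge (lam i) (v r) = 0.
  have /eqP := v0 r; rewrite ch mulf_eq0 (negPf ka0) /= => /prodf_eq0 [i _ /eqP].
  by rewrite form_perp => ?; exists i.
have [f hf] := fin_all_exists ex.
have sc r : exists2 a : C, a != 0 & forall k, lam (f r) k = a * v r k.
  exists (vdot (v r) (lam (f r))); last exact: wedge0_scale.
  apply/negP => /eqP a0; apply: (lam0 (f r)) => k.
  by rewrite (wedge0_scale (hf r) (v1 r)) a0 mul0r.
have f_inj : injective f.
  move=> r q e; apply/eqP; apply: contraT => rq; case/negP: (vw _ _ rq).
  have [a a0 ha] := sc r; have := hf q; rewrite -e (wedgeZ _ ha) => /eqP.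
  by rewrite mulf_eq0 (negPf a0).
by exists (perm f_inj) => r; rewrite permE.
Qed.

(** * Simplicity and rank from n distinct K-roots *)

Section Simple.
Variables (realK : bool) (n : nat) (W : tensor C n n 2) (v : 'I_n -> 'I_2 -> C).
Variable g : 'I_2 -> C.
Hypothesis n_gt0 : (0 < n)%N.
Hypothesis WK : tensK realK W.
Hypotheses (gK : vecK realK g) (cg : charp W g != 0).
Hypothesis vK : forall r, unitK realK (v r).
Hypothesis vw : forall r q, r != q -> wedge (v r) (v q) != 0.
Hypothesis v0 : forall r, charp W (perp (v r)) = 0.

(** [charp_factor] supplies factors over C, possibly not over K. Each is proportional to a different
    [v r], and the scalars are collected in [ka]. *)
Lemma charp_split : exists2 ka : C, ka != 0 &
  forall h, charp W h = ka * \prod_(r < n) \sum_(k < 2) v r k * h k.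
Proof.
have [ka [mu [mu1 ch]]] := charp_factor n_gt0 cg.
have [p hp] := roots_match cg ch (fun r => (vK r).2) vw v0.
have /fin_all_exists [a ha] : forall r, exists a : C, forall k, mu (p r) k = a * v r k.
  by move=> r; have [a _ ?] := hp r; exists a.
have ch' h : charp W h = ka * \prod_r a r * \prod_(r < n) \sum_(k < 2) v r k * h k.
  rewrite ch -mulrA -big_split /=; congr (_ * _); rewrite (reindex_inj (@perm_inj _ p)) /=.
  by apply: eq_bigr => r _; rewrite mulr_sumr; apply: eq_bigr => k _; rewrite ha mulrA.
exists (ka * \prod_r a r) => //; apply: contra cg => /eqP e.
by rewrite ch' e mul0r.
Qed.

Lemma form_neq0 r : \sum_(k < 2) v r k * g k != 0.
Proof.
have [ka _ ch] := charp_split; apply: contra cg => /eqP e.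
by rewrite ch (bigD1 r) //= e mul0r mulr0.
Qed.

Lemma simple_of_roots : simple realK W.
Proof.
split; first by exists g; split=> //; rewrite unitmxE unitfE.
have [ka ka0 ch] := charp_split.
pose i0 : 'I_n := Ordinal n_gt0.
(* A spectrum is a product of forms with no constant in front, so [ka] is absorbed by the form of
   index [i0]. *)
pose b (r : 'I_n) : C := if r == i0 then ka else 1.
have b0 r : b r != 0 by rewrite /b; case: ifP => // _; apply: oner_neq0.
have bE : \prod_r b r = ka.
  rewrite (bigD1 i0) //= /b eqxx big1 ?mulr1 // => r /negPf -> //.
(* [ka] is a quotient of two values at the K-vector [g], both in K. *)
have kaK : inK realK ka.
  have -> : ka = charp W g / \prod_(r < n) \sum_(k < 2) v r k * g k.
    rewrite ch mulfK //; apply/prodf_neq0 => r _; exact: form_neq0.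
  apply: inKM; first by apply: mxK_det; apply: mxK_comb.
  apply/inKV/inK_prod => r; apply: inK_sum => k; apply: inKM => //; exact: (vK r).1.
exists (fun r k => b r * v r k); split; last first.
  move=> i j ij [c hc]; case/negP: (vw ij); apply/eqP.
  have : wedge (v i) (fun k => b j * v j k) = 0.
    have e k : v i k = ((b i)^-1 * c) * (b j * v j k) by rewrite -mulrA -hc mulKf.
    by rewrite (wedgeZ _ e) /wedge; ring.
  rewrite wedgeC (@wedgeZ _ (b j) _ _ (v j)) // => /eqP.
  by rewrite oppr_eq0 mulf_eq0 (negPf (b0 j)) /= wedgeC oppr_eq0 => /eqP.
split; first by exists g.
  move=> r k; apply: inKM; last exact: (vK r).1.
  by rewrite /b; case: ifP => // _; apply: inK_real.
move=> h; rewrite ch -bE -big_split /=; apply: eq_bigr => r _.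
by rewrite mulr_sumr; apply: eq_bigr => k _; rewrite mulrA.
Qed.

Let M h := \sum_(k < 2) h k *: W k.
Let Mu : M g \in unitmx. Proof. by rewrite unitmxE unitfE. Qed.
Let lf r (h : 'I_2 -> C) := \sum_(k < 2) v r k * h k.

(** The form of [v r] vanishes at (lf r g) h - (lf r h) g, so this vector is a multiple of
    [perp (v r)], whose slice combination kills x. Thus x is a joint generalized eigenvector. *)
Lemma pencil_kernel r (x : 'cV[C]_n) h : M (perp (v r)) *m x = 0 ->
  M h *m x = (lf r h / lf r g) *: (M g *m x).
Proof.
move=> Mx; have e : lf r g *: M h - lf r h *: M g = wedge h g *: M (perp (v r)).
  rewrite /M /lf !sum_ord2 !scalerDr !scalerA opprD addrACA -!scalerBl /perp /wedge /=.
  by congr (_ *: _ + _ *: _); ring.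
have : lf r g *: (M h *m x) = lf r h *: (M g *m x).
  apply/eqP; rewrite -subr_eq0 !scalemxAl -mulmxBl e -scalemxAl Mx scaler0 //.
move=> /(congr1 (GRing.scale (lf r g)^-1)); rewrite !scalerA mulVf ?form_neq0 // scale1r => ->.
by rewrite mulrC.
Qed.

Lemma Krank_of_roots : has_Krank realK W n.
Proof.
split; last first.
  (* A decomposition with F terms factors every slice combination through dimension F, while [M g]
     has rank n. *)
  move=> F Fn [A [B [Cm [_ _ _ eW]]]].
  have : (n <= F)%N.
    rewrite -{1}(mxrank_unit Mu) /M eW cpd_comb -mulmxA.
    exact: leq_trans (mxrankM_maxl _ _) (rank_leq_col _).
  by rewrite leqNgt Fn.
have /fin_all_exists [x hx] : forall r, exists x : 'cV[C]_n,
    [/\ mxK realK x, x != 0 & M (perp (v r)) *m x = 0].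
  by move=> r; apply: mxK_kernel (v0 r); apply: mxK_comb WK (vecK_perp (vK r).1).
pose X := \matrix_(i, r) x r i 0.
have colX r : col r X = x r by apply/matrixP => i j; rewrite !mxE ord1.
have colM (Z : 'M[C]_n) r : Z *m x r = col r (Z *m X) by rewrite -colX !colE mulmxA.
pose c := fun k => (g k)^*.
pose d r := lf r (perp c) / lf r g.
have gg : g 0 * (g 0)^* + g 1 * (g 1)^* != 0.
  apply: contra cg => /eqP e; apply/eqP/charp_zero => //; apply: vnorm_eq0.
  by rewrite /vnorm sum_ord2 !normCK e sqrtC0.
(* After cross-multiplication the difference of [d r] and [d q] becomes [wedge (v r) (v q)] times
   |g|^2. *)
have d_inj : injective d.
  move=> r q; rewrite /d => /eqP; rewrite eqr_div ?form_neq0 // -subr_eq0 => e.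
  apply/eqP; apply: contraT => rq; case/negP: (mulf_neq0 (vw rq) gg).
  by move: e; rewrite /lf !form_perp !sum_ord2 /wedge /c; congr (_ == 0); ring.
(* The [x r] are eigenvectors of [invmx (M g) *m M (perp c)] for distinct eigenvalues [d r], hence
   independent. The transposes are there because eigenspaces consist of row vectors. *)
have Xu : X \in unitmx.
  pose N := (invmx (M g) *m M (perp c))^T.
  have dir : mxdirect (\sum_r eigenspace N (d r)).
    by apply: mxdirect_sum_eigenspace => r q _ _; apply: d_inj.
  have xE r : ((x r)^T <= eigenspace N (d r))%MS.
    apply/eigenspaceP; rewrite -trmx_mul -mulmxA (pencil_kernel (r := r)); last by case: (hx r).
    by rewrite -scalemxAr mulKmx // linearZ.
  rewrite -unitmx_tr -row_free_unit -kermx_eq0; apply/rowV0P => u /sub_kermxP uX.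
  apply/rowP => r; rewrite [RHS]mxE.
  have uE : \sum_q u 0 q *: (x q)^T = 0.
    rewrite -[RHS]uX [RHS]mulmx_sum_row; apply: eq_bigr => q _.
    by rewrite -colX tr_col.
  have : (u 0 r *: (x r)^T <=
      (eigenspace N (d r) :&: \sum_(j | true && (j != r)) eigenspace N (d j)))%MS.
    rewrite sub_capmx scalemx_sub //=.
    have -> : u 0 r *: (x r)^T = - \sum_(j | j != r) u 0 j *: (x j)^T.
      by apply/eqP; rewrite -addr_eq0; move: uE; rewrite (bigD1 r) //= => ->.
    rewrite eqmx_opp; apply: summx_sub => j jr; apply: scalemx_sub.
    by apply: submx_trans (xE j) _; apply: (sumsmx_sup j).
  rewrite (mxdirect_sumsP dir) // submx0 scaler_eq0 => /orP[/eqP//|].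
  by rewrite trmx_eq0; case: (hx r) => _ /negPf ->.
(* Column by column, [pencil_kernel] reads M h X = M g X D(h), with D(h) diagonal with entries
   [lf r h / lf r g]; multiplying by the inverse of X yields these factor matrices. *)
exists (M g *m X), (invmx X)^T, (\matrix_(k, r) (v r k / lf r g)).
have XK : mxK realK X by move=> i r; rewrite mxE; case: (hx r).
split.
- by apply: mxK_mul => //; apply: mxK_comb WK gK.
- by move=> i j; rewrite mxE; apply: mxK_inv.
- move=> k r; rewrite mxE; apply: inKM; first exact: (vK r).1.
  by apply/inKV/inK_sum => l; apply: inKM => //; exact: (vK r).1.
apply/ffunP => k0; pose e k : C := (k == k0)%:R.
have sume (Z : tensor C n n 2) : Z k0 = \sum_(k < 2) e k *: Z k.
  rewrite (bigD1 k0) //= /e eqxx scale1r big1 ?addr0 // => k /negPf ->.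
  by rewrite scale0r.
rewrite (sume W) [RHS]sume cpd_comb trmxK -/(M e).
rewrite -[LHS](mulmxK Xu); congr (_ *m _); apply/matrixP => i r.
have := congr1 (fun Z : 'cV_n => Z i 0) (pencil_kernel (r := r) (x := x r) e _).
rewrite mul_mx_diag => h.
have -> : (M e *m X) i r = (M e *m x r) i 0 by rewrite colM [RHS]mxE.
rewrite h; last by case: (hx r).
rewrite colM [LHS]mxE [in LHS]mxE [RHS]mxE mulrC; congr (_ * _).
rewrite !mxE /lf mulr_suml; apply: eq_bigr => k _; rewrite mxE; ring.
Qed.

End Simple.

(** * Perturbation of the spectrum over an archimedean field *)

Theorem eigenvalue_perturbation realK n (T W : tensor C n n 2)
    (A B : 'M[C]_n) (Cm : 'M[C]_(2, n)) (lamT : 'I_n -> 'I_2 -> C) (sA sB s : C) :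
  (forall x : C, 0 <= x -> exists N : nat, x < N%:R) -> (1 < n)%N ->
  tensK realK T -> tensK realK W -> mxK realK Cm -> T = cpd A B Cm ->
  (forall r : 'I_n, vnorm (fun k => Cm k r) = 1) ->
  is_spectrum realK T lamT ->
  is_sigma_min A sA -> is_sigma_min B sB ->
  is_spnorm realK (tsub T W) s ->
  (forall i j : 'I_n, i != j -> s < sA * sB * chi (lamT i) (lamT j) / 2) ->
  [/\ simple realK W, has_Krank realK W n &
      forall lamW : 'I_n -> 'I_2 -> C, is_spectrum realK W lamW ->
        exists p : 'S_n, forall r : 'I_n,
          chi (lamT r) (lamW (p r)) <= s / (sA * sB)].
Proof.
move=> archi n1 hT hW hC eT C1 [[g cg] _ chT] hA hB hs hgap.
have n0 := ltnW n1; have s0 := spnorm_ge0 hs.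
pose i0 : 'I_n := Ordinal n0; pose i1 : 'I_n := Ordinal n1.
(* Since s >= 0, the strict bound for one pair forces both singular values to be nonzero; n > 1
   supplies the pair. *)
have : sA * sB * chi (lamT i0) (lamT i1) / 2 != 0.
  by rewrite gt_eqF // (le_lt_trans s0) // hgap.
rewrite !mulf_eq0 !negb_or -!andbA => /and4P[A0 B0 _ _].
have sAp : 0 < sA by case: hA => ? _ _; rewrite lt_def A0.
have sBp : 0 < sB by case: hB => ? _ _; rewrite lt_def B0.
have sABp : 0 < sA * sB by apply: mulr_gt0.
pose eps := s / (sA * sB); have e0 : 0 <= eps by rewrite (divr_ge0 s0) // ltW.
have egap i j : i != j -> eps + eps < chi (lamT i) (lamT j).
  move=> ij; rewrite -mulr2n -mulr_natr mulrAC ltr_pdivrMr // [ltRHS]mulrC.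
  by rewrite -ltr_pdivlMr // hgap.
have lam0 r : exists k, lamT r k != 0.
  have := cg; rewrite chT (bigD1 r) //= mulf_eq0 negb_or sum_ord2 => /andP[+ _].
  have [-> |] := eqVneq (lamT r 0) 0; last by exists 0.
  have [-> |] := eqVneq (lamT r 1) 0; last by exists 1.
  by rewrite !mul0r addr0 eqxx.
pose c r k := Cm k r.
pose u r k := (vnorm (lamT r))^-1 * lamT r k.
have nu r : vnorm (lamT r) != 0 by have [k /vnorm_normalize[]] := lam0 r.
have u1 r : vnorm (u r) = 1 by have [k /vnorm_normalize[]] := lam0 r.
have lamE r k : lamT r k = vnorm (lamT r) * u r k by rewrite /u mulVKf.
have chiu i j : chi (lamT i) (lamT j) = `|wedge (u i) (u j)|.
  exact: (chi_scale (lamE i) (lamE j)).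
have uw r q : r != q -> wedge (u r) (u q) != 0.
  by move=> /egap; rewrite chiu -normr_gt0; apply: le_lt_trans; rewrite addr_ge0.
have u_root r : charp T (perp (u r)) = 0.
  rewrite chT (bigD1 r) //= form_perp (wedgeZ _ (lamE r)) wedgexx.
  by rewrite mulr0 mul0r.
have chC h : charp T h = \det A * \det B * \prod_(r < n) \sum_(k < 2) c r k * h k.
  by rewrite {1}eT charp_cpd.
have [p hp] := roots_match cg chC u1 uw u_root.
(* Both vectors are unit, so the scalar is a phase, and the modulus of [wedge] is the same for [c]
   as for [u]. *)
have hpn r : exists2 a : C, `|a| = 1 & forall k, c (p r) k = a * u r k.
  have [a a0 ha] := hp r; exists a => //.
  by have := vnormZ ha; rewrite u1 mulr1 C1.
have cK r : unitK realK (c r) by split; [move=> k; apply: hC | apply: C1].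
have cgap i j : i != j -> eps + eps < `|wedge (c i) (c j)|.
  move=> ij; rewrite -[ i ](permKV p) -[j](permKV p).
  have [a a1 ha] := hpn (p^-1 i)%g; have [b b1 hb] := hpn (p^-1 j)%g.
  rewrite (wedgeZ _ ha) normrM a1 mul1r norm_wedgeC (wedgeZ _ hb) normrM b1 mul1r.
  by rewrite norm_wedgeC -chiu egap // (inj_eq perm_inj).
(* There are finitely many pairs, so a common lower bound can be kept strictly above [eps + eps]. *)
have [G gapG hG] : exists2 G : C, eps + eps < G &
    forall i j, i != j -> G <= `|wedge (c i) (c j)|.
  pose r := [seq `|wedge (c q.1) (c q.2)| | q <- enum [pred q : 'I_n * 'I_n | q.1 != q.2]].
  have [|x|G gapG hG] := @strict_lower_bound _ (eps + eps) r.
  - by rewrite ger0_real // addr_ge0.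
  - case/mapP => q; rewrite mem_enum inE => q12 ->; split; first exact: normr_real.
    exact: cgap.
  exists G => // i j ij; apply: hG; apply/mapP; exists (i, j) => //.
  by rewrite mem_enum inE.
have c_root r : charp T (perp (c r)) = 0.
  rewrite chC (bigD1 r) //= form_perp wedgexx.
  by rewrite mul0r mulr0.
have loc (t : C) v : 0 <= t <= 1 -> unitK realK v ->
    charp (segment T W t) (perp v) = 0 -> exists r, `|wedge (c r) v| <= eps.
  by move=> t01 vK; apply: (bauer_fike hT hW eT hA hB A0 B0 hs).
have /fin_all_exists [v hv] := rooted1 n1 archi hT hW cK e0 gapG hG c_root loc.
have [l lK hl] := nonroot_exists n1 cK e0 gapG hG loc.
have cgW : charp W (perp l) != 0 by rewrite -[W](segment1 T W) hl // ler01 lexx.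
have gK : vecK realK (perp l) by apply/vecK_perp/lK.1.
have vK r : unitK realK (v r) by case: (hv r).
have v0 r : charp W (perp (v r)) = 0 by case: (hv r); rewrite segment1.
have vc r : `|wedge (c r) (v r)| <= eps by case: (hv r).
(* Proportional roots in two discs would bring the centres within [eps + eps]. *)
have vw r q : r != q -> wedge (v r) (v q) != 0.
  move=> rq; apply/negP => /eqP w0; have : eps + eps < eps + eps.
    apply: lt_le_trans (cgap _ _ rq) _.
    apply: le_trans (wedge_triangle (cK r).2 (cK q).2 (vK r).2) _; apply: lerD => //.
    apply: le_trans (wedge_triangle (vK r).2 (cK q).2 (vK q).2) _.
    by rewrite w0 normr0 add0r norm_wedgeC.
  by rewrite ltxx.
split; [exact: (simple_of_roots n0 hW gK cgW vK vw v0)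
       |exact: (Krank_of_roots n0 hW gK cgW vK vw v0)|].
move=> lamW [_ _ chW].
have [|q hq] := roots_match (ka := 1) (lam := lamW) cgW _ (fun r => (vK r).2) vw v0.
  by move=> h; rewrite mul1r.
(* [p] leads from the given spectrum of T to the columns of [Cm], which index the discs, and [q]
   from the discs to the spectrum of W. *)
exists (p * q)%g => r; rewrite permM.
have [a a1 ha] := hpn r; have [b b0 hb] := hq (p r).
have a0 : a != 0 by rewrite -normr_eq0 a1 oner_neq0.
have lamc k : lamT r k = (vnorm (lamT r) / a) * c (p r) k.
  by rewrite ha mulrA divfK // -lamE.
by rewrite (chi_scale lamc hb) ?mulf_neq0 ?invr_eq0 // ?(cK _).2 ?(vK _).2.
Qed.

End Roots.

Lemma complex_archimedean (R : realType) (x : R[i]) : 0 <= x -> exists N : nat, x < N%:R.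
Proof.
move=> x0; have xE := RRe_real (ger0_real x0).
exists (Num.bound (complex.Re x)); rewrite -xE -(rmorph_nat (real_complex R)) ltcR.
by apply: archi_boundP; rewrite -lecR xE.
Qed.

(** The minimum over i != j becomes a bound for every pair, and n > 1 ensures that there is a pair.
    The matching distance is unfolded: for each listing [lamW] of the spectrum of W, one permutation
    meets the bound at all r. *)
Theorem theorem2p8 (R : realType) (realK : bool) (n : nat) (hn : (1 < n)%N)
  (T W : tensor R[i] n n 2)
  (A B : 'M[R[i]]_n) (Cm : 'M[R[i]]_(2, n))
  (lamT : 'I_n -> 'I_2 -> R[i]) (sA sB s : R[i]) :
  tensK realK T -> tensK realK W ->
  has_Krank realK T n ->
  mxK realK A -> mxK realK B -> mxK realK Cm ->
  T = cpd A B Cm ->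
  (forall r : 'I_n, vnorm (fun k => Cm k r) = 1) ->
  is_spectrum realK T lamT ->
  is_sigma_min A sA -> is_sigma_min B sB ->
  is_spnorm realK (tsub T W) s ->
  (forall i j : 'I_n, i != j -> s < sA * sB * chi (lamT i) (lamT j) / 2) ->
  [/\ simple realK W, has_Krank realK W n &
      forall lamW : 'I_n -> 'I_2 -> R[i], is_spectrum realK W lamW ->
        exists p : 'S_n, forall r : 'I_n,
          chi (lamT r) (lamW (p r)) <= s / (sA * sB)].
Proof.
move=> hT hW _ _ _ hC eT C1 spT hA hB hs hgap.
exact: (eigenvalue_perturbation (@complex_archimedean R) hn hT hW hC eT C1 spT hA hB hs hgap).
Qed.
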